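(* Let $x_{min}=1.4616\ldots$ be the point where the Euler gamma function $\Gamma$ attains its only minimum on $(0,\infty)$, and put $x_1=x_{min}-1=0.4616\ldots$. For $a>0$ let $\Gamma_{\{a\}}(x)=\frac{\Gamma(ax)}{\Gamma(a)}$. Then for every $a\in(0,x_1]$ the function $\Gamma_{\{a\}}$ is $l$-Weierstrass on $J=(0,1]$, i.e. $\Gamma_{\{a\}}(xy)\geq\Gamma_{\{a\}}(x)+\Gamma_{\{a\}}(y)-1$ for all $x,y\in(0,1]$. In particular, $\Gamma_{\{a\}}$ is a Weierstrass function on $J=(0,1]$ for every $a\in(0,\xi]$, i.e. $\Gamma_{\{a\}}(x)+\Gamma_{\{a\}}(y)-1\leq\Gamma_{\{a\}}(xy)\leq\Gamma_{\{a\}}(x)\Gamma_{\{a\}}(y)$ for all $x,y\in(0,1]$, where $\xi=0.21609\ldots$ is the positive solution $x=\xi$ of the equation $$\sum_{n=1}^{\infty}\frac{2nx+x^2}{n(n+x)^2}=\gamma,$$ with $\gamma=0.577215\ldots$ Euler's constant.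
   Context: A positive function $f$ on $J=(0,1]$ with $f(1)=1$ is called $l$-Weierstrass on $J$ if $f(xy)\geq f(x)+f(y)-1$ for all $x,y\in J$, and a Weierstrass function on $J$ if $f(x)+f(y)-1\leq f(xy)\leq f(x)f(y)$ for all $x,y\in J$. *)

(* Defs.v *)
(* Concrete classical reals of Stdlib, with Coquelicot's total operators. *)
From Stdlib Require Import Reals.
From Coquelicot Require Import Coquelicot.

Local Open Scope R_scope.

(* Euler's integral of the second kind, improper at both ends; it converges
   for x > 0, and only such arguments are relevant. *)
Definition Gamma (x : R) : R :=
  RInt_gen (fun t : R => Rpower t (x - 1) * exp (- t))
    (at_right 0) (Rbar_locally p_infty).

Definition Gamma_scaled (a x : R) : R := Gamma (a * x) / Gamma a.

Definition euler_gamma : R :=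
  real (Lim_seq (fun n : nat => sum_n_m (fun k : nat => / INR k) 1 n - ln (INR n))).

Definition minimizer_on_pos (f : R -> R) (x : R) : Prop :=
  0 < x /\ forall y : R, 0 < y -> f x <= f y.

(* Functions on J = (0,1] are represented by total functions on R, of which
   only the values on (0,1] matter. *)
Definition in_J (x : R) : Prop := 0 < x <= 1.

Definition normalized_positive (f : R -> R) : Prop :=
  (forall x : R, in_J x -> 0 < f x) /\ f 1 = 1.

Definition l_Weierstrass (f : R -> R) : Prop :=
  normalized_positive f /\
  forall x y : R, in_J x -> in_J y -> f (x * y) >= f x + f y - 1.

Definition Weierstrass (f : R -> R) : Prop :=
  normalized_positive f /\
  forall x y : R, in_J x -> in_J y ->
    f x + f y - 1 <= f (x * y) <= f x * f y.

(* The summand with index n >= 1 sits at position n - 1, as is_series starts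
   at 0. *)
Definition xi_equation (x : R) : Prop :=
  is_series
    (fun k : nat => let n := INR (S k) in
       (2 * n * x + x ^ 2) / (n * (n + x) ^ 2))
    euler_gamma.

(* Main.v *)
Require Import Defs.
From Stdlib Require Import Reals Lra Lia.
From Coquelicot Require Import Coquelicot.

Local Open Scope R_scope.

(** Put [G u = Gamma (u + 1) = u * Gamma u], and for [x, y] in (0,1] and [a > 0]
    write [p = axy], [q = ax], [r = ay], so that [p a = q r].

    The lower bound is [Gamma p + Gamma a >= Gamma q + Gamma r].  Since
    [Gamma u = G u / u], it follows from two properties of [G] on (0,a]: it is
    convex, and it is nonincreasing
    ([l_Weierstrass_Gamma_scaled]).  Convexity holds everywhere, and a convex
    function decreases up to its minimizer, so that every [a <= xmin - 1] is
    covered.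

    The upper bound is [Gamma p * Gamma a <= Gamma q * Gamma r], equivalently
    [G p * G a <= G q * G r], as [p a = q r].  By Gauss's product, [ln (G u)]
    differs from [u ln m - sum_(k <= m) ln (k + u)], up to a constant that depends
    on [m] only, by at most [1/m] ([ln_Gamma_Gauss]); this follows from the
    log-convexity of Gamma, as in the Bohr-Mollerup theorem.
    With [D = p + a - q - r >= 0] one has [(k+p)(k+a) - (k+q)(k+r) = k D], and
    [ln v >= 1 - 1/v] yields
    [ln ((k+p)(k+a)) - ln ((k+q)(k+r)) >= D k / (k + xi)^2] when everything
    is at most [xi].  So the inequality already holds for the m-th
    approximation as soon as [ln m <= sum_(k <= m) k / (k + xi)^2]
    ([ln_le_sum_weight]).  The terms of the series defining [xi] are
    [1/k - k / (k + xi)^2] and are nonnegative, so their m-th partial sum is at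
    most [gamma <= H_m - ln m], where [H_m] is the m-th harmonic number: this is
    exactly the required estimate.  The same estimate shows that [G]
    decreases on (0,xi] ([Gamma_succ_decreasing]), which gives the lower bound
    there without comparing [xi] with [xmin - 1].

    The number [xi] exists by the intermediate value theorem, and is unique
    because each term of the series increases strictly with [x]; moreover
    [xi <= 1], because the series is at least [1 >= gamma] at [x = 1]. *)

(** * Euler's integral *)

(** The integrals over compact subintervals grow with the interval, so the
    improper integral is their least upper bound. *)
Lemma RInt_gen_nonneg_bounded (f : R -> R) (M : R) :
  (forall t, 0 < t -> continuous f t) ->
  (forall t, 0 < t -> 0 <= f t) ->
  (forall a b, 0 < a <= b -> RInt f a b <= M) ->
  exists l, is_RInt_gen f (at_right 0) (Rbar_locally p_infty) l /\
    forall a b, 0 < a <= b -> RInt f a b <= l.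
Proof.
intros Hc Hp HM.
assert (Hex : forall a b, 0 < a <= b -> ex_RInt f a b).
{ intros a b Hab. apply (@ex_RInt_continuous R_CompleteNormedModule).
  intros z Hz. rewrite Rmin_left, Rmax_right in Hz by lra. apply Hc; lra. }
assert (Hmono : forall a a0 b0 b, 0 < a -> a <= a0 -> a0 <= b0 -> b0 <= b ->
    RInt f a0 b0 <= RInt f a b).
{ intros a a0 b0 b H1 H2 H3 H4.
  rewrite <- (RInt_Chasles f a a0 b), <- (RInt_Chasles f a0 b0 b)
    by (apply Hex; lra).
  assert (0 <= RInt f a a0).
  { apply RInt_ge_0; [lra | apply Hex; lra |]. intros; apply Hp; lra. }
  assert (0 <= RInt f b0 b).
  { apply RInt_ge_0; [lra | apply Hex; lra |]. intros; apply Hp; lra. }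
  unfold plus; simpl; lra. }
destruct (completeness (fun v => exists a b, 0 < a <= b /\ v = RInt f a b))
  as [l [Hub Hlub]].
- exists M. intros v (a & b & Hab & ->). now apply HM.
- exists (RInt f 1 1), 1, 1. split; [lra | reflexivity].
- assert (Hle : forall a b, 0 < a <= b -> RInt f a b <= l).
  { intros a b Hab. apply Hub. exists a, b. now split. }
  exists l. split; [| exact Hle].
  intros P [eps HP].
  assert (Hnear : exists a0 b0, 0 < a0 <= b0 /\ l - eps < RInt f a0 b0).
  { apply Classical_Prop.NNPP. intros Hn.
    assert (l <= l - eps); [| destruct eps; simpl in *; lra].
    apply Hlub. intros v (a & b & Hab & ->).
    apply Rnot_lt_le. intros Hlt. apply Hn. now exists a, b. }
  destruct Hnear as (a0 & b0 & H0 & Hlt).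
  apply Filter_prod with (Q := fun a => 0 < a < a0) (R := fun b => b0 < b).
  + assert (Ha0 : 0 < a0) by lra.
    exists (mkposreal a0 Ha0). intros y Hy Hy0. split; [exact Hy0 |].
    unfold ball in Hy; simpl in Hy.
    unfold AbsRing_ball, abs, minus, plus, opp in Hy; simpl in Hy.
    apply Rabs_def2 in Hy. lra.
  + exists b0. intros; assumption.
  + intros a b Ha Hb. exists (RInt f a b). split.
    * apply (@RInt_correct R_CompleteNormedModule), Hex; simpl; lra.
    * apply HP. unfold ball; simpl.
      unfold AbsRing_ball, abs, minus, plus, opp; simpl.
      assert (RInt f a0 b0 <= RInt f a b) by (apply Hmono; lra).
      assert (RInt f a b <= l) by (apply Hle; lra).
      apply Rabs_def1; lra.
Qed.

Lemma exp_le_compat u v : u <= v -> exp u <= exp v.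
Proof.
intros [H | ->]; [apply Rlt_le, exp_increasing, H | apply Rle_refl].
Qed.

Definition gamma_integrand (x t : R) : R := Rpower t (x - 1) * exp (- t).

Lemma gamma_integrand_pos x t : 0 < gamma_integrand x t.
Proof. apply Rmult_lt_0_compat; apply exp_pos. Qed.

Lemma gamma_integrand_continuous x t : 0 < t -> continuous (gamma_integrand x) t.
Proof.
intros Ht. apply (@ex_derive_continuous R_AbsRing R_NormedModule).
unfold gamma_integrand, Rpower. auto_derive. exact Ht.
Qed.

Lemma gamma_integrand_exp x t :
  gamma_integrand x t = exp ((x - 1) * ln t - t).
Proof.
unfold gamma_integrand, Rpower. rewrite <- exp_plus. f_equal; ring.
Qed.

(** The constant comes from [x ln t <= x ln (2x) + t/2], which follows from the
    tangent to the logarithm at [2x]. *)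
Lemma gamma_integrand_decay x : 0 < x ->
  exists C, 0 < C /\
    forall t, 0 < t -> gamma_integrand (x + 1) t <= C * exp (- (t / 2)).
Proof.
intros Hx. exists (exp (x * ln (2 * x))). split; [apply exp_pos |].
intros t Ht. rewrite gamma_integrand_exp, <- exp_plus.
assert (Hln : ln t <= ln (2 * x) + t / (2 * x)).
{ assert (Hq : 0 < t / (2 * x)) by (apply Rdiv_lt_0_compat; lra).
  replace (ln t) with (ln (2 * x) + ln (t / (2 * x))).
  - assert (ln (t / (2 * x)) <= t / (2 * x)); [| lra].
    apply Rle_trans with (ln (exp (t / (2 * x)))); [| rewrite ln_exp; lra].
    apply ln_le; [exact Hq |].
    pose proof (exp_ineq1_le (t / (2 * x))). lra.
  - rewrite <- ln_mult by lra. f_equal. field. lra. }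
apply exp_le_compat.
assert (H : x * ln t <= x * (ln (2 * x) + t / (2 * x)))
  by (apply Rmult_le_compat_l; lra).
replace (x * (ln (2 * x) + t / (2 * x))) with (x * ln (2 * x) + t / 2) in H
  by (field; lra).
lra.
Qed.

Lemma gamma_integrand_derive x t : 0 < t ->
  is_derive (gamma_integrand (x + 1)) t
    (x * gamma_integrand x t - gamma_integrand (x + 1) t).
Proof.
intros Ht. unfold gamma_integrand, Rpower. auto_derive; [exact Ht |].
replace ((x + 1 - 1) * ln t) with ((x - 1) * ln t + ln t) by ring.
rewrite exp_plus, exp_ln by exact Ht. field. lra.
Qed.

(** Integration by parts removes the singularity at [0]: [x t^(x-1) e^-t] differs
    from [t^x e^-t <= C e^(-t/2)] by the derivative of a bounded function.  Hence
    one explicit bounded primitive controls both ends at once. *)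
Lemma is_RInt_gen_Gamma x : 0 < x ->
  is_RInt_gen (gamma_integrand x) (at_right 0) (Rbar_locally p_infty) (Gamma x)
  /\ 0 < Gamma x.
Proof.
intros Hx. destruct (gamma_integrand_decay x Hx) as [C [HC Hdec]].
(* [dF] dominates the integrand and is the derivative of the bounded [F]. *)
pose (dF := fun t => gamma_integrand x t
   + (C * exp (- (t / 2)) - gamma_integrand (x + 1) t) / x).
pose (F := fun t => (gamma_integrand (x + 1) t - 2 * C * exp (- (t / 2))) / x).
assert (HF : forall t, 0 < t -> is_derive F t (dF t)).
{ intros t Ht.
  pose proof (gamma_integrand_derive x t Ht) as Hd.
  unfold F, dF. auto_derive.
  - now exists (x * gamma_integrand x t - gamma_integrand (x + 1) t).
  - replace (Derive (fun x0 => gamma_integrand (x + 1) x0) t)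
      with (x * gamma_integrand x t - gamma_integrand (x + 1) t)
      by (symmetry; now apply is_derive_unique).
    change (t * / 2) with (t / 2). field. lra. }
assert (HdF : forall t, 0 < t -> continuous dF t).
{ intros t Ht. apply (@ex_derive_continuous R_AbsRing R_NormedModule).
  unfold dF, gamma_integrand, Rpower. auto_derive. repeat split; lra. }
destruct (RInt_gen_nonneg_bounded (gamma_integrand x) (3 * C / x))
  as [l [Hl Hle]].
- intros t Ht. now apply gamma_integrand_continuous.
- intros t _. apply Rlt_le, gamma_integrand_pos.
- intros a b Hab.
  assert (HI : is_RInt dF a b (minus (F b) (F a))).
  { apply (@is_RInt_derive R_CompleteNormedModule); intros t Ht;
      rewrite Rmin_left, Rmax_right in Ht by lra; [apply HF | apply HdF]; lra. }
  apply Rle_trans with (RInt dF a b).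
  + apply RInt_le; [lra | | now exists (minus (F b) (F a)) |].
    * apply (@ex_RInt_continuous R_CompleteNormedModule). intros t Ht.
      rewrite Rmin_left, Rmax_right in Ht by lra.
      apply gamma_integrand_continuous; lra.
    * intros t Ht. unfold dF.
      assert (0 <= (C * exp (- (t / 2)) - gamma_integrand (x + 1) t) / x); [| lra].
      apply Rdiv_le_0_compat; [| exact Hx].
      specialize (Hdec t ltac:(lra)). lra.
  + rewrite (is_RInt_unique _ _ _ _ HI).
    unfold minus, plus, opp, F; simpl.
    assert (Hb := Hdec b ltac:(lra)).
    assert (Ha := gamma_integrand_pos (x + 1) a).
    assert (He : forall t, 0 < t -> 0 < exp (- (t / 2)) <= 1).
    { intros t Ht. split; [apply exp_pos |]. rewrite <- exp_0.
      apply exp_le_compat; lra. }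
    assert (Hea := He a ltac:(lra)). assert (Heb := He b ltac:(lra)).
    apply Rmult_le_reg_r with x; [exact Hx |].
    rewrite Rmult_plus_distr_r, Ropp_mult_distr_l_reverse.
    unfold Rdiv at 1 3 5. rewrite !Rmult_assoc, Rinv_l by lra.
    nra.
- assert (HG : Gamma x = l) by (apply (is_RInt_gen_unique _ _ Hl)).
  rewrite HG. split; [exact Hl |].
  apply Rlt_le_trans with (RInt (gamma_integrand x) 1 2); [| apply Hle; lra].
  apply RInt_gt_0; [lra | intros; apply gamma_integrand_pos |].
  intros t Ht. apply gamma_integrand_continuous; lra.
Qed.

Lemma Gamma_pos x : 0 < x -> 0 < Gamma x.
Proof. intros Hx. now apply is_RInt_gen_Gamma. Qed.

Lemma Gamma_integral x : 0 < x ->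
  is_RInt_gen (gamma_integrand x) (at_right 0) (Rbar_locally p_infty) (Gamma x).
Proof. intros Hx. now apply is_RInt_gen_Gamma. Qed.

Lemma pos_interval_prod :
  filter_prod (at_right 0) (Rbar_locally p_infty)
    (fun ab : R * R => 0 < fst ab <= snd ab).
Proof.
apply Filter_prod with (Q := fun a => 0 < a < 1) (R := fun b => 1 < b).
- exists (mkposreal 1 Rlt_0_1). intros y Hy Hy0. split; [exact Hy0 |].
  unfold ball in Hy; simpl in Hy.
  unfold AbsRing_ball, abs, minus, plus, opp in Hy; simpl in Hy.
  apply Rabs_def2 in Hy. lra.
- exists 1. intros; assumption.
- simpl; intros; lra.
Qed.

(** At both ends the boundary term [t^x e^-t] of the integration by parts
    vanishes. *)
Lemma gamma_integrand_lim_0 x : 0 < x ->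
  filterlim (gamma_integrand (x + 1)) (at_right 0) (locally 0).
Proof.
intros Hx P [eps HP].
exists (mkposreal (Rpower eps (/ x)) (exp_pos _)). intros y Hy Hy0.
unfold ball in Hy; simpl in Hy.
unfold AbsRing_ball, abs, minus, plus, opp in Hy; simpl in Hy.
apply Rabs_def2 in Hy.
apply HP. unfold ball; simpl.
unfold AbsRing_ball, abs, minus, plus, opp; simpl.
pose proof (gamma_integrand_pos (x + 1) y).
apply Rabs_def1; [| destruct eps; simpl in *; lra].
rewrite Ropp_0, Rplus_0_r. unfold gamma_integrand.
apply Rle_lt_trans with (Rpower y x).
- replace (x + 1 - 1) with x by ring.
  rewrite <- (Rmult_1_r (Rpower y x)) at 2.
  apply Rmult_le_compat_l; [apply Rlt_le, exp_pos |].
  rewrite <- exp_0. apply exp_le_compat; lra.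
- replace (pos eps) with (Rpower (Rpower eps (/ x)) x).
  + apply Rlt_Rpower_l; lra.
  + rewrite Rpower_mult, Rinv_l, Rpower_1; [reflexivity | apply cond_pos | lra].
Qed.

Lemma gamma_integrand_lim_infty x : 0 < x ->
  filterlim (gamma_integrand (x + 1)) (Rbar_locally p_infty) (locally 0).
Proof.
intros Hx. destruct (gamma_integrand_decay x Hx) as [C [HC Hdec]].
intros P [eps HP].
exists (Rmax 0 (- 2 * ln (eps / C))). intros y Hy.
apply Rmax_Rlt in Hy as [Hy0 Hy].
apply HP. unfold ball; simpl.
unfold AbsRing_ball, abs, minus, plus, opp; simpl.
pose proof (gamma_integrand_pos (x + 1) y).
apply Rabs_def1; [| destruct eps; simpl in *; lra].
rewrite Ropp_0, Rplus_0_r.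
apply Rle_lt_trans with (1 := Hdec y Hy0).
assert (He : exp (- (y / 2)) < eps / C).
{ rewrite <- (exp_ln (eps / C)).
  - apply exp_increasing; lra.
  - apply Rdiv_lt_0_compat; [apply cond_pos | exact HC]. }
apply Rmult_lt_compat_l with (r := C) in He; [| exact HC].
replace (C * (eps / C)) with (pos eps) in He by (field; lra).
exact He.
Qed.

(** Integrate the derivative of [t^x e^-t], namely
    [x t^(x-1) e^-t - t^x e^-t], over the half-line. *)
Lemma Gamma_succ x : 0 < x -> Gamma (x + 1) = x * Gamma x.
Proof.
intros Hx.
assert (Hd : forall t, 0 < t -> Derive (gamma_integrand (x + 1)) t =
    x * gamma_integrand x t - gamma_integrand (x + 1) t).
{ intros t Ht. now apply is_derive_unique, gamma_integrand_derive. }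
assert (H0 : is_RInt_gen (Derive (gamma_integrand (x + 1)))
    (at_right 0) (Rbar_locally p_infty) (0 - 0)).
{ apply is_RInt_gen_Derive;
    [| | now apply gamma_integrand_lim_0 | now apply gamma_integrand_lim_infty];
    generalize pos_interval_prod; apply filter_imp; intros [a b]; simpl;
    intros Hab t Ht; rewrite Rmin_left, Rmax_right in Ht by lra.
  - eexists. apply gamma_integrand_derive. lra.
  - apply continuous_ext_loc with
      (fun t => x * gamma_integrand x t - gamma_integrand (x + 1) t).
    + assert (Ht0 : 0 < t) by lra.
      exists (mkposreal t Ht0). intros y Hy.
      unfold ball in Hy; simpl in Hy.
      unfold AbsRing_ball, abs, minus, plus, opp in Hy; simpl in Hy.
      apply Rabs_def2 in Hy. symmetry. apply Hd. lra.
    + apply (@ex_derive_continuous R_AbsRing R_NormedModule).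
      unfold gamma_integrand, Rpower. auto_derive. repeat split; lra. }
assert (H1 : is_RInt_gen (Derive (gamma_integrand (x + 1)))
    (at_right 0) (Rbar_locally p_infty) (x * Gamma x - Gamma (x + 1))).
{ apply is_RInt_gen_ext with
    (fun t => minus (scal x (gamma_integrand x t)) (gamma_integrand (x + 1) t)).
  - generalize pos_interval_prod; apply filter_imp; intros [a b]; simpl.
    intros Hab t Ht. rewrite Rmin_left, Rmax_right in Ht by lra.
    symmetry. apply Hd. lra.
  - apply (@is_RInt_gen_minus R_NormedModule _ _ _ _).
    + apply (@is_RInt_gen_scal R_NormedModule _ _ _ _), Gamma_integral, Hx.
    + apply Gamma_integral. lra. }
apply (@is_RInt_gen_unique R_CompleteNormedModule _ _ _ _) in H0, H1.
rewrite H0 in H1. lra.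
Qed.

(** * Convexity of Gamma *)

(** The graph lies above its tangent at [lam * u + (1 - lam) * v]. *)
Lemma exp_convex (lam u v : R) : 0 <= lam <= 1 ->
  exp (lam * u + (1 - lam) * v) <= lam * exp u + (1 - lam) * exp v.
Proof.
intros Hlam. set (m := lam * u + (1 - lam) * v).
assert (Htan : forall w, exp m * (1 + (w - m)) <= exp w).
{ intros w. replace (exp w) with (exp m * exp (w - m))
    by (rewrite <- exp_plus; f_equal; ring).
  apply Rmult_le_compat_l; [apply Rlt_le, exp_pos | apply exp_ineq1_le]. }
apply Rle_trans with
  (lam * (exp m * (1 + (u - m))) + (1 - lam) * (exp m * (1 + (v - m)))).
- apply Req_le. unfold m. ring.
- apply Rplus_le_compat; apply Rmult_le_compat_l; try lra; apply Htan.
Qed.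

(** Hoelder's inequality for Euler's integral: apply Young's inequality, in the
    form of [exp_convex], pointwise to the two integrands normalized by
    [Gamma x] and [Gamma y], then integrate; the right-hand side has
    integral 1. *)
Lemma ln_Gamma_convex (lam x y : R) : 0 <= lam <= 1 -> 0 < x -> 0 < y ->
  ln (Gamma (lam * x + (1 - lam) * y))
    <= lam * ln (Gamma x) + (1 - lam) * ln (Gamma y).
Proof.
intros Hlam Hx Hy. set (z := lam * x + (1 - lam) * y).
set (c := lam * ln (Gamma x) + (1 - lam) * ln (Gamma y)).
assert (Hz : 0 < z).
{ unfold z. destruct (Rle_lt_dec lam (1 / 2)); nra. }
assert (Gx := Gamma_pos x Hx). assert (Gy := Gamma_pos y Hy).
assert (Gz := Gamma_pos z Hz).
assert (HI : norm (exp (- c) * Gamma z) <=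
    lam * / Gamma x * Gamma x + (1 - lam) * / Gamma y * Gamma y).
{ apply (@RInt_gen_norm R_CompleteNormedModule (at_right 0)
    (Rbar_locally p_infty) _ _
    (fun t => scal (exp (- c)) (gamma_integrand z t))
    (fun t => plus (scal (lam * / Gamma x) (gamma_integrand x t))
                   (scal ((1 - lam) * / Gamma y) (gamma_integrand y t)))).
  - generalize pos_interval_prod; apply filter_imp; intros [a b]; simpl; lra.
  - generalize pos_interval_prod; apply filter_imp; intros [a b]; simpl.
    intros Hab t Ht. unfold norm, scal, plus; simpl.
    unfold abs, mult; simpl. rewrite Rabs_pos_eq.
    + rewrite !gamma_integrand_exp, <- exp_plus.
      pose proof (exp_convex lam ((x - 1) * ln t - t - ln (Gamma x))
        ((y - 1) * ln t - t - ln (Gamma y)) Hlam) as Hcv.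
      assert (Hdiv : forall w v, 0 < w -> exp (v - ln w) = / w * exp v).
      { intros w v Hw. unfold Rminus.
        rewrite exp_plus, exp_Ropp, exp_ln by exact Hw. ring. }
      rewrite !Hdiv in Hcv by assumption.
      eapply Rle_trans; [| eapply Rle_trans; [exact Hcv | apply Req_le; ring]].
      apply Req_le. f_equal. unfold z, c. ring.
    + apply Rmult_le_pos; apply Rlt_le; [apply exp_pos | apply gamma_integrand_pos].
  - apply (@is_RInt_gen_scal R_NormedModule _ _ _ _), Gamma_integral, Hz.
  - apply (@is_RInt_gen_plus R_NormedModule _ _ _ _);
      apply (@is_RInt_gen_scal R_NormedModule _ _ _ _); now apply Gamma_integral. }
unfold norm in HI; simpl in HI. unfold abs in HI; simpl in HI.
rewrite Rabs_pos_eq in HI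
  by (apply Rmult_le_pos; apply Rlt_le; [apply exp_pos | exact Gz]).
replace (lam * / Gamma x * Gamma x + (1 - lam) * / Gamma y * Gamma y) with 1 in HI
  by (field; lra).
rewrite <- (ln_exp c). apply ln_le; [exact Gz |].
apply Rmult_le_reg_l with (exp (- c)); [apply exp_pos |].
rewrite <- exp_plus, Rplus_opp_l, exp_0. exact HI.
Qed.

Lemma Gamma_convex (lam x y : R) : 0 <= lam <= 1 -> 0 < x -> 0 < y ->
  Gamma (lam * x + (1 - lam) * y) <= lam * Gamma x + (1 - lam) * Gamma y.
Proof.
intros Hlam Hx Hy.
assert (Hz : 0 < lam * x + (1 - lam) * y)
  by (destruct (Rle_lt_dec lam (1 / 2)); nra).
rewrite <- (exp_ln (Gamma (lam * x + (1 - lam) * y))) by now apply Gamma_pos.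
eapply Rle_trans; [apply exp_le_compat, ln_Gamma_convex; assumption |].
eapply Rle_trans; [apply exp_convex, Hlam |].
rewrite !exp_ln by now apply Gamma_pos. lra.
Qed.

(** * The lower bound from the monotonicity of Gamma (u + 1) *)

Lemma Gamma_scaled_normalized_positive (a : R) : 0 < a ->
  normalized_positive (Gamma_scaled a).
Proof.
intros Ha. split.
- intros x [Hx _]. apply Rdiv_lt_0_compat; apply Gamma_pos; nra.
- unfold Gamma_scaled. rewrite Rmult_1_r. apply Rdiv_diag.
  pose proof (Gamma_pos a Ha). lra.
Qed.

(** With [G u = Gamma (u + 1)], both [ax] and [ay] lie between [axy] and [a].
    Adding the convexity inequality at [ax] to [x] times the one at [ay] gives
    [G (ax) + x G (ay) <= G (axy) + x G a].  Passing to
    [Gamma u = G u / u] leaves the term [(1 - y) (G (ax) - x G a)], which is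
    nonnegative because [G a <= G (ax)]. *)
Lemma l_Weierstrass_Gamma_scaled (A : R) :
  (forall s t, 0 < s <= t -> t <= A -> Gamma (t + 1) <= Gamma (s + 1)) ->
  forall a, 0 < a <= A -> l_Weierstrass (Gamma_scaled a).
Proof.
intros Hdecr a Ha. unfold l_Weierstrass, Gamma_scaled. split.
{ apply Gamma_scaled_normalized_positive; lra. }
intros x y [Hx0 Hx1] [Hy0 Hy1].
assert (Hax : 0 < a * x) by nra. assert (Hay : 0 < a * y) by nra.
assert (Haxy : 0 < a * (x * y)) by (apply Rmult_lt_0_compat; nra).
assert (Ga := Gamma_pos a ltac:(lra)).
enough (Hmain : Gamma (a * x) + Gamma (a * y) <= Gamma (a * (x * y)) + Gamma a).
{ apply Rle_ge, Rmult_le_reg_r with (Gamma a); [exact Ga |].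
  unfold Rdiv. rewrite Rmult_minus_distr_r, Rmult_plus_distr_r, !Rmult_assoc.
  rewrite Rinv_l by lra. lra. }
destruct (Req_dec (x * y) 1) as [Hxy | Hxy].
{ assert (x = 1) by nra. subst x. assert (y = 1) by nra. subst y.
  rewrite !Rmult_1_r. lra. }
assert (Hxy1 : x * y < 1) by nra.
assert (HG : Gamma (a * x + 1) + x * Gamma (a * y + 1)
    <= Gamma (a * (x * y) + 1) + x * Gamma (a + 1)).
{ pose (al := (1 - x) / (1 - x * y)). pose (be := (1 - y) / (1 - x * y)).
  assert (Hal : 0 <= al <= 1).
  { unfold al; split; [apply Rdiv_le_0_compat; lra |].
    apply Rle_div_l; nra. }
  assert (Hbe : 0 <= be <= 1).
  { unfold be; split; [apply Rdiv_le_0_compat; lra |].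
    apply Rle_div_l; nra. }
  assert (Hq := Gamma_convex al (a * (x * y) + 1) (a + 1) Hal
    ltac:(lra) ltac:(lra)).
  assert (Hr := Gamma_convex be (a * (x * y) + 1) (a + 1) Hbe
    ltac:(lra) ltac:(lra)).
  replace (al * (a * (x * y) + 1) + (1 - al) * (a + 1)) with (a * x + 1) in Hq
    by (unfold al; field; lra).
  replace (be * (a * (x * y) + 1) + (1 - be) * (a + 1)) with (a * y + 1) in Hr
    by (unfold be; field; lra).
  (* The weights of [axy] add up to exactly 1; this is why the second
     convexity inequality is taken [x] times. *)
  assert (Hab : al + x * be = 1) by (unfold al, be; field; lra).
  replace (Gamma (a * (x * y) + 1) + x * Gamma (a + 1)) with
    ((al + x * be) * Gamma (a * (x * y) + 1)
      + ((1 + x) - (al + x * be)) * Gamma (a + 1)) by (rewrite Hab; ring).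
  nra. }
assert (Hd : Gamma (a + 1) <= Gamma (a * x + 1)) by (apply Hdecr; nra).
rewrite !(Gamma_succ (a * _)), (Gamma_succ a) in HG by lra.
rewrite !Gamma_succ in Hd by lra.
apply Rmult_le_reg_l with (a * (x * y)); [exact Haxy |].
assert (x * (a * Gamma a) <= a * x * Gamma (a * x)).
{ apply Rle_trans with (2 := Hd). assert (0 < a * Gamma a) by nra. nra. }
assert (0 <= (1 - y) * (a * x * Gamma (a * x) - x * (a * Gamma a)))
  by (apply Rmult_le_pos; lra).
lra.
Qed.

(** * Gauss's product for Gamma *)

Lemma ln_diff_ge (u v : R) : 0 < u -> 0 < v -> 1 - v / u <= ln u - ln v.
Proof.
intros Hu Hv.
assert (Hq : 0 < v / u) by now apply Rdiv_lt_0_compat.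
assert (ln (v / u) <= v / u - 1).
{ rewrite <- (ln_exp (v / u - 1)). apply ln_le; [exact Hq |].
  pose proof (exp_ineq1_le (v / u - 1)). lra. }
rewrite ln_div in H by assumption. lra.
Qed.

Lemma INR_S_ge_1 n : 1 <= INR (S n).
Proof. rewrite S_INR. pose proof (pos_INR n). lra. Qed.

Lemma ln_Gamma_succ x : 0 < x -> ln (Gamma (x + 1)) = ln x + ln (Gamma x).
Proof.
intros Hx. rewrite Gamma_succ by exact Hx.
apply ln_mult; [exact Hx | now apply Gamma_pos].
Qed.

(** Both bounds compare chords of the convex function ln Gamma: [m + 1] lies
    between [m] and [m + 1 + t], and [m + 1 + t] between [m + 1] and [m + 2];
    the slopes over unit intervals are [ln m] and [ln (m + 1) <= ln m + 1/m]. *)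
Lemma ln_Gamma_shift (m t : R) : 0 < m -> 0 < t <= 1 ->
  t * ln m <= ln (Gamma (m + 1 + t)) - ln (Gamma (m + 1)) <= t * ln m + / m.
Proof.
intros Hm Ht. split.
- assert (Hlam : 0 <= t / (1 + t) <= 1).
  { split; [apply Rdiv_le_0_compat; lra | apply Rle_div_l; lra]. }
  assert (H := ln_Gamma_convex _ m (m + 1 + t) Hlam Hm ltac:(lra)).
  replace (t / (1 + t) * m + (1 - t / (1 + t)) * (m + 1 + t)) with (m + 1) in H
    by (field; lra).
  rewrite ln_Gamma_succ in H |- * by exact Hm.
  apply Rmult_le_compat_r with (r := 1 + t) in H; [| lra].
  replace ((t / (1 + t) * ln (Gamma m) +
     (1 - t / (1 + t)) * ln (Gamma (m + 1 + t))) * (1 + t))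
    with (t * ln (Gamma m) + ln (Gamma (m + 1 + t))) in H by (field; lra).
  lra.
- assert (H := ln_Gamma_convex t (m + 1 + 1) (m + 1) ltac:(lra)
    ltac:(lra) ltac:(lra)).
  replace (t * (m + 1 + 1) + (1 - t) * (m + 1)) with (m + 1 + t) in H by ring.
  rewrite (ln_Gamma_succ (m + 1)) in H by lra.
  assert (Hl := ln_diff_ge m (m + 1) Hm ltac:(lra)).
  replace (1 - (m + 1) / m) with (- / m) in Hl by (field; lra).
  assert (0 < / m) by now apply Rinv_0_lt_compat.
  nra.
Qed.

Lemma ln_Gamma_product (t : R) (n : nat) : 0 < t ->
  ln (Gamma (INR (S n) + 1 + t))
    = ln (Gamma (t + 1)) + sum_n (fun k => ln (INR (S k) + t)) n.
Proof.
intros Ht. induction n as [| n IH].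
- rewrite sum_O. simpl INR.
  replace (1 + 1 + t) with (t + 1 + 1) by ring.
  rewrite (ln_Gamma_succ (t + 1)) by lra. replace (1 + t) with (t + 1) by ring. ring.
- rewrite sum_Sn.
  change (ln (Gamma (INR (S (S n)) + 1 + t)) = ln (Gamma (t + 1))
    + (sum_n (fun k => ln (INR (S k) + t)) n + ln (INR (S (S n)) + t))).
  rewrite <- Rplus_assoc, <- IH, (S_INR (S n)).
  replace (INR (S n) + 1 + 1 + t) with (INR (S n) + 1 + t + 1) by ring.
  rewrite ln_Gamma_succ; [ring |]. pose proof (INR_S_ge_1 n). lra.
Qed.

(** Up to the term [ln (Gamma (m + 1))], which cancels in the differences taken
    below, this is Gauss's limit formula for [ln (Gamma (t + 1))], with an
    explicit error. *)
Lemma ln_Gamma_Gauss (t : R) (n : nat) : 0 < t <= 1 ->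
  let m := INR (S n) in
  let e := ln (Gamma (t + 1)) - (ln (Gamma (m + 1)) + t * ln m
             - sum_n (fun k => ln (INR (S k) + t)) n) in
  0 <= e <= / m.
Proof.
intros Ht m e. unfold e.
pose proof (INR_S_ge_1 n).
pose proof (ln_Gamma_shift m t ltac:(unfold m; lra) Ht) as Hs.
unfold m in *. rewrite ln_Gamma_product in Hs by lra. lra.
Qed.

Lemma nonneg_of_ge_inv (X : R) :
  (forall n, - (2 * / INR (S n)) <= X) -> 0 <= X.
Proof.
intros H. apply Rnot_lt_le. intros HX.
destruct (archimed_cor1 (- X / 2)) as (N & HN & HN0); [lra |].
destruct N as [| n]; [lia |].
specialize (H n). lra.
Qed.

(** * Euler's constant *)

(** The harmonic number of index [n + 1], as the sum starts at [k = 0]. *)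
Definition harmonic (n : nat) : R := sum_n (fun k => / INR (S k)) n.

Lemma harmonic_S n : harmonic (S n) = harmonic n + / (INR (S n) + 1).
Proof.
unfold harmonic. rewrite sum_Sn, <- S_INR. reflexivity.
Qed.

Lemma harmonic_minus_ln_lower n : 1 - ln 2 <= harmonic n - ln (INR (S n) + 1).
Proof.
induction n as [| n IH].
- unfold harmonic. rewrite sum_O. simpl.
  replace (1 + 1) with 2 by ring. rewrite Rinv_1. lra.
- rewrite harmonic_S, (S_INR (S n)).
  set (m := INR (S n)) in *. assert (1 <= m) by apply INR_S_ge_1.
  assert (Hl := ln_diff_ge (m + 1) (m + 1 + 1) ltac:(lra) ltac:(lra)).
  replace (1 - (m + 1 + 1) / (m + 1)) with (- / (m + 1)) in Hl by (field; lra).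
  lra.
Qed.

(** The sequence [H_m - ln m] decreases to [euler_gamma], while
    [H_m - ln (m + 1)] increases from [1 - ln 2 > 0]. *)
Lemma euler_gamma_bounds :
  0 < euler_gamma /\ forall n, euler_gamma <= harmonic n - ln (INR (S n)).
Proof.
set (v := fun n => harmonic n - ln (INR (S n))).
assert (Hdec : forall n, v (S n) <= v n).
{ intros n. unfold v. rewrite harmonic_S, (S_INR (S n)).
  set (m := INR (S n)) in *. assert (1 <= m) by apply INR_S_ge_1.
  assert (Hl := ln_diff_ge (m + 1) m ltac:(lra) ltac:(lra)).
  replace (1 - m / (m + 1)) with (/ (m + 1)) in Hl by (field; lra).
  lra. }
assert (Hlow : forall n, 1 - ln 2 <= v n).
{ intros n. unfold v. pose proof (harmonic_minus_ln_lower n).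
  pose proof (INR_S_ge_1 n).
  assert (ln (INR (S n)) <= ln (INR (S n) + 1)) by (apply ln_le; lra).
  lra. }
destruct (ex_finite_lim_seq_decr v (1 - ln 2) Hdec Hlow) as [l Hl].
assert (Hg : euler_gamma = l).
{ unfold euler_gamma. rewrite (is_lim_seq_unique _ l); [reflexivity |].
  apply is_lim_seq_incr_1. apply is_lim_seq_ext with (2 := Hl).
  intros n. unfold v, harmonic, sum_n.
  now rewrite (sum_n_m_S (fun k => / INR k)). }
rewrite Hg. split.
- assert (Hle := is_lim_seq_le _ _ _ _ Hlow (is_lim_seq_const (1 - ln 2)) Hl).
  simpl in Hle.
  assert (ln 2 < 1); [| lra].
  rewrite <- (ln_exp 1). apply ln_increasing; [lra |].
  pose proof (exp_ineq1 1). lra.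
- intros n. apply (is_lim_seq_decr_compare v l Hl Hdec).
Qed.

(** * The equation defining xi *)

Lemma sum_n_le_series (a : nat -> R) (l : R) (n : nat) :
  (forall k, 0 <= a k) -> is_series a l -> sum_n a n <= l.
Proof.
intros Ha Hl. apply (is_lim_seq_incr_compare (sum_n a) l Hl).
intros k. rewrite sum_Sn. unfold plus; simpl. specialize (Ha (S k)). lra.
Qed.

(** The partial sums are bounded by telescoping [1/m^2 <= 1/(m-1) - 1/m]. *)
Lemma ex_series_inv_sqr : ex_series (fun k => / INR (S k) ^ 2).
Proof.
assert (H : forall n, sum_n (fun k => / INR (S k) ^ 2) n <= 2 - / INR (S n)).
{ intros n. induction n as [| n IH].
  - rewrite sum_O. simpl. lra.
  - rewrite sum_Sn, (S_INR (S n)).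
    change (sum_n (fun k => / INR (S k) ^ 2) n + / (INR (S n) + 1) ^ 2
      <= 2 - / (INR (S n) + 1)).
    set (m := INR (S n)) in *. assert (1 <= m) by apply INR_S_ge_1.
    assert (/ (m + 1) ^ 2 <= / m - / (m + 1)); [| lra].
    replace (/ m - / (m + 1)) with (/ (m * (m + 1))) by (field; lra).
    apply Rinv_le_contravar; nra. }
destruct (ex_finite_lim_seq_incr (sum_n (fun k => / INR (S k) ^ 2)) 2)
  as [l Hl].
- intros n. rewrite sum_Sn. unfold plus; simpl AbelianMonoid.sort.
  assert (0 < / INR (S (S n)) ^ 2); [| simpl in *; lra].
  apply Rinv_0_lt_compat, pow_lt. pose proof (INR_S_ge_1 (S n)). lra.
- intros n. specialize (H n). pose proof (INR_S_ge_1 n).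
  assert (0 < / INR (S n)) by (apply Rinv_0_lt_compat; lra). lra.
- now exists l.
Qed.

Definition xi_term (x : R) (k : nat) : R :=
  let n := INR (S k) in (2 * n * x + x ^ 2) / (n * (n + x) ^ 2).

(** In this form the terms are visibly increasing in [x], and summing them
    produces the harmonic numbers. *)
Lemma xi_term_alt x k : 0 <= x ->
  xi_term x k = / INR (S k) - INR (S k) / (INR (S k) + x) ^ 2.
Proof.
intros Hx. unfold xi_term. pose proof (INR_S_ge_1 k). field. lra.
Qed.

(** The bound, summable in [k], makes the sum of the series Lipschitz in [x]. *)
Lemma xi_term_diff x y k : 0 <= x <= y ->
  0 <= xi_term y k - xi_term x k <= 2 * (y - x) * / INR (S k) ^ 2.
Proof.
intros Hxy. rewrite !xi_term_alt by lra.
set (n := INR (S k)). assert (1 <= n) by apply INR_S_ge_1.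
assert (Heq : / n - n / (n + y) ^ 2 - (/ n - n / (n + x) ^ 2)
   = (y - x) * ((n / (n + x) * / (n + y)) * (/ (n + x) + / (n + y))))
  by (field; lra).
rewrite Heq.
assert (Hx : 0 < / (n + x) <= / n).
{ split; [apply Rinv_0_lt_compat | apply Rinv_le_contravar]; lra. }
assert (Hy : 0 < / (n + y) <= / n).
{ split; [apply Rinv_0_lt_compat | apply Rinv_le_contravar]; lra. }
assert (Hq : 0 <= n / (n + x) <= 1).
{ split; [apply Rdiv_le_0_compat | apply Rle_div_l]; lra. }
replace (/ n ^ 2) with (/ n * / n) by (field; lra).
assert (H1 : 0 <= n / (n + x) * / (n + y) <= / n) by nra.
set (c := n / (n + x) * / (n + y)) in *.
assert (H2 : 0 <= c * (/ (n + x) + / (n + y)) <= 2 * (/ n * / n)) by nra.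
split; nra.
Qed.

Lemma xi_term_0 k : xi_term 0 k = 0.
Proof. unfold xi_term. simpl. unfold Rdiv. ring. Qed.

Lemma xi_term_nonneg x k : 0 <= x -> 0 <= xi_term x k.
Proof.
intros Hx. pose proof (xi_term_diff 0 x k ltac:(lra)).
rewrite xi_term_0 in H. lra.
Qed.

Lemma xi_term_increasing x y k : 0 <= x < y -> xi_term x k < xi_term y k.
Proof.
intros Hxy. rewrite !xi_term_alt by lra.
assert (1 <= INR (S k)) by apply INR_S_ge_1.
assert (/ (INR (S k) + y) ^ 2 < / (INR (S k) + x) ^ 2).
{ apply Rinv_lt_contravar; [apply Rmult_lt_0_compat; apply pow_lt; lra | nra]. }
unfold Rdiv. nra.
Qed.

Lemma ex_series_xi_term x : 0 <= x -> ex_series (xi_term x).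
Proof.
intros Hx.
apply (@ex_series_le R_AbsRing R_CompleteNormedModule)
  with (fun k => 2 * x * / INR (S k) ^ 2).
- intros k. unfold norm; simpl. unfold abs; simpl.
  rewrite Rabs_pos_eq by now apply xi_term_nonneg.
  pose proof (xi_term_diff 0 x k ltac:(lra)) as H.
  rewrite xi_term_0 in H. simpl in *. lra.
- apply (@ex_series_scal_l R_AbsRing), ex_series_inv_sqr.
Qed.

Lemma Series_xi_term_lipschitz x y : 0 <= x <= y ->
  0 <= Series (xi_term y) - Series (xi_term x)
    <= 2 * (y - x) * Series (fun k => / INR (S k) ^ 2).
Proof.
intros Hxy.
assert (Hd := fun k => xi_term_diff x y k Hxy). split.
- assert (Series (xi_term x) <= Series (xi_term y)); [| lra].
  apply Series_le; [| apply ex_series_xi_term; lra].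
  intros k. split; [apply xi_term_nonneg; lra |]. specialize (Hd k). lra.
- rewrite <- Series_minus by (apply ex_series_xi_term; lra).
  rewrite <- Series_scal_l. apply Series_le; [exact Hd |].
  apply (@ex_series_scal_l R_AbsRing), ex_series_inv_sqr.
Qed.

(** The absolute value extends the sum continuously to the whole line, where the
    terms would otherwise have poles at the negative integers. *)
Lemma Series_xi_term_continuous :
  forall x : R, continuous (fun x => Series (xi_term (Rabs x))) x.
Proof.
intros x. set (C := Series (fun k => / INR (S k) ^ 2)).
assert (HC : 1 <= C).
{ replace 1 with (sum_n (fun k => / INR (S k) ^ 2) 0)
    by (rewrite sum_O; simpl; field).
  apply sum_n_le_series; [| apply Series_correct, ex_series_inv_sqr].
  intros k. apply Rlt_le, Rinv_0_lt_compat, pow_lt.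
  pose proof (INR_S_ge_1 k). lra. }
assert (Hlip : forall y, Rabs (Series (xi_term (Rabs y)) - Series (xi_term (Rabs x)))
    <= 2 * C * Rabs (y - x)).
{ intros y. assert (Hr := Rabs_triang_inv2 y x).
  pose proof (Rabs_pos x). pose proof (Rabs_pos y).
  apply Rle_trans with (2 * C * Rabs (Rabs y - Rabs x));
    [| apply Rmult_le_compat_l; lra].
  destruct (Rle_dec (Rabs x) (Rabs y)) as [Hle | Hle].
  - pose proof (Series_xi_term_lipschitz (Rabs x) (Rabs y) ltac:(lra)) as Hb.
    change (Series (fun k => / INR (S k) ^ 2)) with C in Hb.
    rewrite (Rabs_pos_eq (Series _ - _)), (Rabs_pos_eq (Rabs y - _)) by lra. lra.
  - pose proof (Series_xi_term_lipschitz (Rabs y) (Rabs x) ltac:(lra)) as Hb.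
    change (Series (fun k => / INR (S k) ^ 2)) with C in Hb.
    rewrite (Rabs_left1 (Series _ - _)), (Rabs_left1 (Rabs y - _)) by lra. lra. }
intros P [eps HP].
assert (Hd : 0 < eps / (2 * C)).
{ apply Rdiv_lt_0_compat; [apply cond_pos | lra]. }
exists (mkposreal _ Hd). intros y Hy. apply HP.
unfold ball in *; simpl in *.
unfold AbsRing_ball, abs, minus, plus, opp in *; simpl in *.
eapply Rle_lt_trans; [apply Hlip |].
apply Rmult_lt_compat_l with (r := 2 * C) in Hy; [| lra].
replace (2 * C * (eps / (2 * C))) with (pos eps) in Hy by (field; lra).
exact Hy.
Qed.

(** The bound [xi <= 1] keeps [xi] in the range of [ln_Gamma_Gauss].  At [x = 1]
    the first two terms, [3/4 + 5/18], already exceed [1 >= euler_gamma]. *)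
Lemma xi_exists : exists xi, 0 < xi <= 1 /\ xi_equation xi.
Proof.
destruct euler_gamma_bounds as [Hg0 Hg1].
assert (HS0 : Series (xi_term 0) = 0).
{ transitivity (Series (fun k => 0 * / INR (S k) ^ 2)).
  - apply Series_ext. intros k. rewrite xi_term_0. ring.
  - rewrite Series_scal_l. ring. }
assert (HS1 : 1 <= Series (xi_term 1)).
{ apply Rle_trans with (sum_n (xi_term 1) 1).
  - rewrite sum_Sn, sum_O. unfold plus, xi_term; simpl. lra.
  - apply sum_n_le_series; [intros; apply xi_term_nonneg; lra |].
    apply Series_correct, ex_series_xi_term. lra. }
destruct (IVT_gen_consistent (fun x => Series (xi_term (Rabs x))) 0 1 euler_gamma)
  as (xi & Hxi & Hval).
- apply Series_xi_term_continuous.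
- rewrite Rabs_R0, Rabs_R1, HS0, Rmin_left, Rmax_right by lra.
  specialize (Hg1 0%nat). unfold harmonic in Hg1. rewrite sum_O in Hg1.
  simpl in Hg1. rewrite ln_1, Rinv_1 in Hg1. lra.
- rewrite Rmin_left, Rmax_right in Hxi by lra.
  rewrite Rabs_pos_eq in Hval by lra.
  exists xi. split.
  + destruct (Req_dec xi 0) as [-> | Hne]; [| lra].
    rewrite HS0 in Hval. lra.
  + unfold xi_equation. rewrite <- Hval.
    apply (Series_correct (xi_term xi)), ex_series_xi_term. lra.
Qed.

Lemma xi_unique x y : 0 < x -> 0 < y -> xi_equation x -> xi_equation y -> x = y.
Proof.
assert (Hlt : forall x y, 0 < x < y -> xi_equation x -> xi_equation y -> False).
{ clear. intros x y Hxy Hx Hy.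
  assert (Hd := is_series_minus _ _ _ _ Hy Hx).
  assert (H0 := fun h => sum_n_le_series _ _ 0 h Hd).
  rewrite sum_O in H0.
  change ((forall k, 0 <= xi_term y k - xi_term x k) ->
    xi_term y 0 - xi_term x 0 <= euler_gamma - euler_gamma) in H0.
  assert (Hinc := fun k => xi_term_increasing x y k ltac:(lra)).
  assert (Hinc0 := Hinc 0%nat).
  assert (xi_term y 0 - xi_term x 0 <= euler_gamma - euler_gamma); [| lra].
  apply H0. intros k. specialize (Hinc k). lra. }
intros H0x H0y Hx Hy.
destruct (Rtotal_order x y) as [H | [H | H]]; [| exact H |]; exfalso; eauto.
Qed.

(** * The two inequalities below xi *)

(** With [m = k + 1], a lower bound for [m / ((m + p) (m + a))] and for
    [1 / (m + t)] that is uniform in [p, a, t <= xi]; these are the rates at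
    which the m-th factor of Gauss's product enters the two inequalities. *)
Definition weight (xi : R) (k : nat) : R := INR (S k) / (INR (S k) + xi) ^ 2.

(** The only place where the equation for [xi] enters: the weights and the terms
    of the series add up to [H_m], the terms to at most [euler_gamma], and
    [euler_gamma <= H_m - ln m]. *)
Lemma ln_le_sum_weight (xi : R) (n : nat) : 0 < xi -> xi_equation xi ->
  ln (INR (S n)) <= sum_n (weight xi) n.
Proof.
intros Hxi Heq.
assert (Hsum : sum_n (weight xi) n + sum_n (xi_term xi) n = harmonic n).
{ unfold harmonic. rewrite <- (sum_n_plus (weight xi) (xi_term xi)).
  apply sum_n_ext. intros k. rewrite xi_term_alt by lra.
  unfold plus, weight; simpl. ring. }
assert (Hle : sum_n (xi_term xi) n <= euler_gamma).
{ apply sum_n_le_series; [| exact Heq].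
  intros k. apply xi_term_nonneg. lra. }
pose proof (proj2 euler_gamma_bounds n). lra.
Qed.

Lemma sum_n_scal_le (d : R) (c f : nat -> R) (n : nat) :
  (forall k, d * c k <= f k) -> d * sum_n c n <= sum_n f n.
Proof.
intros H. rewrite <- (sum_n_mult_l (K := R_Ring)).
apply (sum_n_m_le (fun k => d * c k)), H.
Qed.

Lemma sum_n_minus (f g : nat -> R) (n : nat) :
  sum_n (fun k => f k - g k) n = sum_n f n - sum_n g n.
Proof.
induction n as [| n IH]; [now rewrite !sum_O |].
rewrite !sum_Sn, IH. unfold plus; simpl. ring.
Qed.

(** In Gauss's product the linear term [(t - s) ln m] is dominated by the sum of
    [ln ((k + t) / (k + s)) >= (t - s) / (k + t) >= (t - s) k / (k + xi)^2]. *)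
Lemma Gamma_succ_decreasing (xi s t : R) : 0 < xi <= 1 -> xi_equation xi ->
  0 < s <= t -> t <= xi -> Gamma (t + 1) <= Gamma (s + 1).
Proof.
intros Hxi Heq Hs Ht.
enough (Hln : 0 <= ln (Gamma (s + 1)) - ln (Gamma (t + 1))).
{ rewrite <- (exp_ln (Gamma (t + 1))), <- (exp_ln (Gamma (s + 1)))
    by (apply Gamma_pos; lra).
  apply exp_le_compat. lra. }
apply nonneg_of_ge_inv. intros n.
assert (Es := ln_Gamma_Gauss s n ltac:(lra)).
assert (Et := ln_Gamma_Gauss t n ltac:(lra)). cbv zeta in Es, Et.
assert (Hsum : (t - s) * sum_n (weight xi) n <=
   sum_n (fun k => ln (INR (S k) + t) - ln (INR (S k) + s)) n).
{ apply sum_n_scal_le. intros k. unfold weight.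
  set (m := INR (S k)). assert (1 <= m) by apply INR_S_ge_1.
  eapply Rle_trans; [| apply ln_diff_ge; lra].
  replace (1 - (m + s) / (m + t)) with ((t - s) * / (m + t)) by (field; lra).
  apply Rmult_le_compat_l; [lra |].
  apply Rle_div_l; [apply pow_lt; lra |].
  apply Rmult_le_reg_l with (m + t); [lra |].
  rewrite <- Rmult_assoc, Rinv_r by lra. nra. }
rewrite sum_n_minus in Hsum.
assert (Hw := ln_le_sum_weight xi n ltac:(lra) Heq).
assert (0 < / INR (S n)).
{ apply Rinv_0_lt_compat. pose proof (INR_S_ge_1 n). lra. }
apply Rmult_le_compat_l with (r := t - s) in Hw; [lra | lra].
Qed.

(** As a function of [ln t], [ln (Gamma t)] is concave for [t <= xi]; the proof
    checks this in finite form on each of Gauss's approximations. *)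
Lemma Gamma_log_submodular (xi a x y : R) : 0 < xi <= 1 -> xi_equation xi ->
  0 < a <= xi -> in_J x -> in_J y ->
  Gamma (a * (x * y)) * Gamma a <= Gamma (a * x) * Gamma (a * y).
Proof.
intros Hxi Heq Ha [Hx0 Hx1] [Hy0 Hy1].
set (q := a * x). set (r := a * y). set (p := a * (x * y)).
assert (Hq : 0 < q <= xi) by (unfold q; nra).
assert (Hr : 0 < r <= xi) by (unfold r; nra).
assert (Hxy : 0 < x * y <= 1) by nra.
assert (Hp : 0 < p <= xi) by (unfold p; nra).
assert (Hprod : p * a = q * r) by (unfold p, q, r; ring).
assert (HD : 0 <= p + a - q - r).
{ replace (p + a - q - r) with (a * ((1 - x) * (1 - y)))
    by (unfold p, q, r; ring).
  apply Rmult_le_pos; [lra | apply Rmult_le_pos; lra]. }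
clearbody p q r.
assert (Gp := Gamma_pos p ltac:(lra)). assert (Ga := Gamma_pos a ltac:(lra)).
assert (Gq := Gamma_pos q ltac:(lra)). assert (Gr := Gamma_pos r ltac:(lra)).
enough (Hln : 0 <= ln (Gamma (q + 1)) + ln (Gamma (r + 1))
    - ln (Gamma (p + 1)) - ln (Gamma (a + 1))).
{ rewrite !ln_Gamma_succ in Hln by lra.
  assert (Hl : ln p + ln a = ln q + ln r)
    by (rewrite <- !ln_mult by lra; now rewrite Hprod).
  rewrite <- (exp_ln (Gamma p * Gamma a)), <- (exp_ln (Gamma q * Gamma r))
    by now apply Rmult_lt_0_compat.
  apply exp_le_compat. rewrite !ln_mult by assumption. lra. }
apply nonneg_of_ge_inv. intros n.
assert (Ep := ln_Gamma_Gauss p n ltac:(lra)).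
assert (Ea := ln_Gamma_Gauss a n ltac:(lra)).
assert (Eq := ln_Gamma_Gauss q n ltac:(lra)).
assert (Er := ln_Gamma_Gauss r n ltac:(lra)).
cbv zeta in Ep, Ea, Eq, Er.
assert (Hsum : (p + a - q - r) * sum_n (weight xi) n <=
   sum_n (fun k => ln (INR (S k) + p) - ln (INR (S k) + q)
     - (ln (INR (S k) + r) - ln (INR (S k) + a))) n).
{ apply sum_n_scal_le. intros k. unfold weight.
  set (m := INR (S k)). assert (1 <= m) by apply INR_S_ge_1.
  assert (Hu : 0 < (m + p) * (m + a)) by nra.
  assert (Hv : 0 < (m + q) * (m + r)) by nra.
  assert (Hl := ln_diff_ge _ _ Hu Hv).
  rewrite !ln_mult in Hl by lra.
  (* [(m + p) (m + a)] and [(m + q) (m + r)] have the same constant term, so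
     their difference is [m (p + a - q - r)]. *)
  assert (Hfrac : 1 - (m + q) * (m + r) / ((m + p) * (m + a))
      = (p + a - q - r) * (m / ((m + p) * (m + a)))).
  { apply Rmult_eq_reg_r with ((m + p) * (m + a)); [| lra].
    replace ((m + q) * (m + r)) with (m * m + m * (q + r) + p * a)
      by (rewrite Hprod; ring).
    field. lra. }
  rewrite Hfrac in Hl.
  assert (m / (m + xi) ^ 2 <= m / ((m + p) * (m + a))).
  { apply Rmult_le_compat_l; [lra |]. apply Rinv_le_contravar; [exact Hu | nra]. }
  nra. }
rewrite !sum_n_minus in Hsum.
assert (Hw := ln_le_sum_weight xi n ltac:(lra) Heq).
assert (0 < / INR (S n)).
{ apply Rinv_0_lt_compat. pose proof (INR_S_ge_1 n). lra. }
apply Rmult_le_compat_l with (r := p + a - q - r) in Hw; [lra | exact HD].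
Qed.

Theorem theorem4 (xmin : R) (hxmin : unique (minimizer_on_pos Gamma) xmin) :
  (forall a : R, 0 < a <= xmin - 1 -> l_Weierstrass (Gamma_scaled a)) /\
  (exists xi : R,
     unique (fun x : R => 0 < x /\ xi_equation x) xi /\
     forall a : R, 0 < a <= xi -> Weierstrass (Gamma_scaled a)).
Proof.
split.
- destruct hxmin as [[Hpos Hmin] _].
  intros a Ha. apply l_Weierstrass_Gamma_scaled with (xmin - 1); [| exact Ha].
  (* [t + 1] lies between [s + 1] and the minimizer, so by convexity Gamma takes
     there at most the larger value, [Gamma (s + 1)]. *)
  intros s t Hs Ht.
  destruct (Req_dec s t) as [-> | Hst]; [lra |].
  set (lam := (xmin - (t + 1)) / (xmin - (s + 1))).
  assert (Hlam : 0 <= lam <= 1).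
  { unfold lam; split; [apply Rdiv_le_0_compat | apply Rle_div_l]; lra. }
  assert (Hcv := Gamma_convex lam (s + 1) xmin Hlam ltac:(lra) Hpos).
  replace (lam * (s + 1) + (1 - lam) * xmin) with (t + 1) in Hcv
    by (unfold lam; field; lra).
  specialize (Hmin (s + 1) ltac:(lra)). nra.
- destruct xi_exists as (xi & Hxi & Heq). exists xi. split.
  + split; [split; [lra | exact Heq] |].
    intros x [Hx Hxeq]. apply xi_unique; [lra | exact Hx | exact Heq | exact Hxeq].
  + intros a Ha.
    destruct (l_Weierstrass_Gamma_scaled xi) with (a := a) as [Hnorm Hl];
      [| exact Ha |].
    { intros s t. now apply Gamma_succ_decreasing. }
    split; [exact Hnorm |]. intros x y Hx Hy. split.
    * apply Rge_le, Hl; assumption.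
    * assert (Hsub := Gamma_log_submodular xi a x y Hxi Heq Ha Hx Hy).
      assert (Ga := Gamma_pos a ltac:(lra)).
      unfold Gamma_scaled.
      apply Rmult_le_reg_r with (Gamma a * Gamma a); [nra |].
      replace (Gamma (a * (x * y)) / Gamma a * (Gamma a * Gamma a))
        with (Gamma (a * (x * y)) * Gamma a) by (field; lra).
      replace (Gamma (a * x) / Gamma a * (Gamma (a * y) / Gamma a)
        * (Gamma a * Gamma a)) with (Gamma (a * x) * Gamma (a * y))
        by (field; lra).
      exact Hsub.
Qed.
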